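(* Consider the SWEMED1 system $\partial_t W+A(W)\partial_x W=S(W)$ for $W=(h,hu_m,h\alpha_1,hc_m,h_b)^T$, with the source term $S$ given in the context, bottom-friction coefficient $\epsilon>0$ and $\nu>0$. Then its source equilibrium manifold $\mathcal E=\{W\in G:\ S(W)=0\}$ is the fully-settled water-at-rest equilibrium manifold $$\mathcal E_{wr}=\{W\in G:\ u_m=0,\ \alpha_1=0,\ c_m=0\}.$$
   Context: The state is $W=(h,hu_m,h\alpha_1,hc_m,h_b)^T\in\mathbb R^5$, where $h$ is the water height, $u_m$ the mean velocity, $\alpha_1$ the first velocity-moment coefficient, $c_m$ the depth-averaged suspended sediment concentration and $h_b$ the bed elevation. The admissible set is $G=\{W\in\mathbb R^5: h>0,\ 0\le c_m\le 1\}$. The bottom velocity is $u_b=u_m+\alpha_1$. The source term is $$S(W)=\begin{pmatrix}\frac{E-D}{1-\psi}\\ -\epsilon|u_b|u_b+\frac{E-D}{1-\psi}u_b\\ -3\left(\epsilon|u_b|u_b+4\frac{\nu}{h}\alpha_1\right)+2\frac{E-D}{1-\psi}\alpha_1\\ E-D\\ \frac{D-E}{1-\psi}\end{pmatrix}.$$ Entrainment and deposition rates: $E=\omega_0(1-\psi)E_s$ and $D=\omega_0 S_b c_m$, with $$E_s=\frac{1.3\times10^{-7}\mathcal Z^5}{1+4.3\times10^{-7}\mathcal Z^5},\qquad \mathcal Z=\frac{\gamma_1\sqrt{c_D}\,|u_b|}{\omega_0}\mathcal R_p^{\gamma_2}.$$ Here $\psi\in[0,1)$ (porosity), $\omega_0>0$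 (settling velocity), $S_b>0$ (near-bed concentration factor), $c_D>0$ (bed drag coefficient), $\mathcal R_p>0$ (particle Reynolds number) are constants, and $(\gamma_1,\gamma_2)=(1,0.6)$ if $\mathcal R_p>2.36$, $(\gamma_1,\gamma_2)=(0.586,1.23)$ if $\mathcal R_p\le 2.36$. The source equilibrium manifold depends only on $S$, not on the transport matrix $A$. *)

(* Defs.v *)
From mathcomp Require Import all_boot all_order all_algebra.
From mathcomp Require Import all_classical all_reals all_analysis.

Set Implicit Arguments.
Unset Strict Implicit.
Unset Printing Implicit Defensive.

Import Order.TTheory GRing.Theory Num.Theory.

Local Open Scope classical_set_scope.
Local Open Scope ring_scope.

Record swemed_params (R : realType) := SwemedParams {
  epsilon : R;  (* bottom-friction coefficient *)
  nu : R;       (* viscosity *)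
  psi : R;      (* porosity *)
  omega0 : R;   (* settling velocity *)
  S_b : R;      (* near-bed concentration factor *)
  c_D : R;      (* bed drag coefficient *)
  R_p : R       (* particle Reynolds number *)
}.

Definition params_ok (R : realType) (p : swemed_params R) : Prop :=
  [/\ 0 < epsilon p, 0 < nu p, 0 <= psi p < 1 & 0 < omega0 p] /\
  [/\ 0 < S_b p, 0 < c_D p & 0 < R_p p].

(* The components of W are the conserved variables (h, h u_m, h alpha_1,
   h c_m, h_b); u_m, alpha_1 and c_m are recovered by dividing by h, which is
   only meaningful for h > 0, as is the case on the admissible set. *)
Section State.
Variables (R : realType) (W : 'cV[R]_5).

Definition h : R := W 0 0.
Definition u_m : R := W 1 0 / h.
Definition alpha_1 : R := W 2 0 / h.
Definition c_m : R := W 3 0 / h.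
Definition h_b : R := W 4 0.

Definition u_b : R := u_m + alpha_1.

End State.

Definition admissible (R : realType) : set 'cV[R]_5 :=
  [set W | 0 < h W /\ 0 <= c_m W <= 1].

Section Source.
Variables (R : realType) (p : swemed_params R).

Definition gamma_1 : R := if 236 / 100 < R_p p then 1 else 586 / 1000.
Definition gamma_2 : R := if 236 / 100 < R_p p then 6 / 10 else 123 / 100.

Variable W : 'cV[R]_5.

Definition calZ : R :=
  gamma_1 * Num.sqrt (c_D p) * `|u_b W| / omega0 p * R_p p `^ gamma_2.

Definition E_s : R :=
  13 / 10 * 10 ^- 7 * calZ ^+ 5 / (1 + 43 / 10 * 10 ^- 7 * calZ ^+ 5).

Definition entrainment : R := omega0 p * (1 - psi p) * E_s.
Definition deposition : R := omega0 p * S_b p * c_m W.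

Definition source : 'cV[R]_5 :=
  let E := entrainment in
  let D := deposition in
  let eps := epsilon p in
  let ub := u_b W in
  \col_(i < 5)
    [:: (E - D) / (1 - psi p);
        - eps * `|ub| * ub + (E - D) / (1 - psi p) * ub;
        - 3 * (eps * `|ub| * ub + 4 * (nu p / h W) * alpha_1 W)
          + 2 * ((E - D) / (1 - psi p)) * alpha_1 W;
        E - D;
        (D - E) / (1 - psi p)]`_i.

End Source.

Definition source_equilibria (R : realType) (p : swemed_params R) :
    set 'cV[R]_5 :=
  [set W | admissible W /\ source p W = 0].

Definition water_at_rest (R : realType) : set 'cV[R]_5 :=
  [set W | admissible W /\ [/\ u_m W = 0, alpha_1 W = 0 & c_m W = 0]].

(* Main.v *)
Require Import Defs.
From mathcomp Require Import all_boot all_order all_algebra.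
From mathcomp Require Import all_classical all_reals all_analysis.

(** The components of the source have a triangular structure, so that its
    zeros can be read off one unknown at a time.

    The sediment balance gives E = D, which removes every exchange term from
    the two momentum balances.  What is left of the first one is the bottom
    friction - eps |u_b| u_b, and it vanishes only for u_b = 0.  The second one
    is then reduced to the viscous term - 12 (nu / h) alpha_1, hence
    alpha_1 = 0, and u_m = u_b - alpha_1 = 0.  Finally, water at rest at the
    bottom entrains nothing ([entrainment_eq0]), so E = D becomes
    0 = omega_0 S_b c_m and all the sediment has settled.

    Conversely, at rest and without suspended sediment E and D both vanish,
    and each remaining term has a factor u_b or alpha_1. *)

Set Implicit Arguments.
Unset Strict Implicit.
Unset Printing Implicit Defensive.

Import Order.TTheory GRing.Theory Num.Theory.

Local Open Scope ring_scope.

Lemma normr_mulr_eq0 (R : numDomainType) (x : R) : (`|x| * x == 0) = (x == 0).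
Proof. by rewrite mulf_eq0 normr_eq0 orbb. Qed.

(** The entrainment rate depends on the flow through [calZ] only, which is
    proportional to the bottom speed, and [E_s] is a multiple of [calZ ^+ 5]. *)
Lemma entrainment_eq0 (R : realType) (p : swemed_params R) (W : 'cV[R]_5) :
  u_b W = 0 -> entrainment p W = 0.
Proof.
move=> ub0; have Z0 : calZ p W = 0 by rewrite /calZ ub0 normr0 mulr0 !mul0r.
by rewrite /entrainment /E_s Z0 expr0n /= mulr0 mul0r mulr0.
Qed.

(** Since each exchange term is a multiple of E - D, the mass and bed
    components add nothing to the sediment balance and only three scalar
    equations remain. *)
Lemma source_eq0P (R : realType) (p : swemed_params R) (W : 'cV[R]_5) :
  source p W = 0 <->
  [/\ entrainment p W = deposition p W,
      epsilon p * `|u_b W| * u_b W = 0 &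
      epsilon p * `|u_b W| * u_b W + 4 * (nu p / h W) * alpha_1 W = 0].
Proof.
split=> [S0 | [ED momentum moment]].
  have S0i (i : 'I_5) : source p W i 0 = 0 by rewrite S0 mxE.
  have /eqP := S0i 3; rewrite mxE /= subr_eq0 => /eqP ED.
  have /eqP := S0i 1; rewrite mxE /= ED subrr !mul0r addr0 !mulNr oppr_eq0.
  move=> /eqP momentum.
  have /eqP := S0i 2; rewrite mxE /= ED subrr mul0r mulr0 mul0r addr0.
  by rewrite mulNr oppr_eq0 mulf_eq0 pnatr_eq0 /= => /eqP.
apply/matrixP => i j; rewrite !mxE ED subrr !mul0r mulr0 mul0r !addr0.
rewrite !mulNr moment momentum mulr0 oppr0.
by case: i => [[|[|[|[|[|]]]]]].
Qed.

Theorem theorem1 (R : realType) (p : swemed_params R) (hp : params_ok p) :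
  source_equilibria p = @water_at_rest R.
Proof.
have [[eps_gt0 nu_gt0 _ omega_gt0] [Sb_gt0 _ _]] := hp.
apply/seteqP; split=> W [W_adm].
  move=> /source_eq0P[ED momentum moment]; split=> //.
  have [h_gt0 _] := W_adm.
  have ub0 : u_b W = 0.
    move/eqP: momentum.
    by rewrite -mulrA mulf_eq0 (gt_eqF eps_gt0) normr_mulr_eq0 => /eqP.
  have alpha0 : alpha_1 W = 0.
    have viscous_gt0 : 0 < 4 * (nu p / h W).
      by rewrite mulr_gt0 ?ltr0n // divr_gt0.
    move/eqP: moment.
    by rewrite momentum add0r mulf_eq0 (gt_eqF viscous_gt0) => /eqP.
  have um0 : u_m W = 0 by move: ub0; rewrite /u_b alpha0 addr0.
  have c0 : c_m W = 0.
    have settling_gt0 : 0 < omega0 p * S_b p by rewrite mulr_gt0.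
    move: ED; rewrite entrainment_eq0 // => /esym/eqP.
    by rewrite mulf_eq0 (gt_eqF settling_gt0) => /eqP.
  by [].
move=> [um0 alpha0 c0]; split=> //.
have ub0 : u_b W = 0 by rewrite /u_b um0 alpha0 addr0.
apply/source_eq0P; split.
- by rewrite entrainment_eq0 // /deposition c0 mulr0.
- by rewrite ub0 mulr0.
- by rewrite ub0 alpha0 !mulr0 addr0.
Qed.
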